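(* (a) There exist matroids whose matroid polytope $P(f)$ (with the representation below) is GCW but not ICW, i.e. has a circuit walk that is not integral. (b) There exist transportation polytopes (with the representation below) that are ICW but not VCW. (c) There exist bounded-size partition polytopes $PP(\kappa^{\pm})$ (with the representation below) that are VCW but not ECW. (d) All fixed-size partition polytopes $PP(\kappa)$ (with the representation below) are ECW.
   Context: Circuits: for $P=\{x: Ax=b,\ Bx\le d\}$ with rational $A,B$, $\mathcal C(A,B)$ is the set of $g\in\ker(A)\setminus\{0\}$ with coprime integer components such that the support of $Bg$ is inclusion-minimal among supports of $Bx$, $x\in\ker(A)\setminus\{0\}$. For vertices $v^{(1)},v^{(2)}$ of $P$, a circuit walk is a sequence $v^{(1)}=y^{(0)},\dots,y^{(k)}=v^{(2)}$ with $y^{(i)}\in P$, $y^{(i+1)}=y^{(i)}+\alpha_i g^{(i)}$ for some $g^{(i)}\in\mathcal C(A,B)$, $\alpha_i>0$, and $y^{(i)}+\alpha g^{(i)}\notin P$ for all $\alpha>\alpha_i$. It is integral if all $y^{(i)}$ are integer, a vertex walk if all $y^{(i)}$ are vertices, an edge walk if it is a vertex walk and each $[y^{(i)},y^{(i+1)}]$ is an edge of $P$. An integral polyhedron (all vertices integer) is GCW; it is ICW if all its circuit walks are integral, VCW if all are vertex walks, ECW if all are edge walks. Matroid polytope: for a matroid with ground set $E$ and rank function $f$, $P(f)=\{x\in\mathbb R^E: x\ge 0,\ \sum_{e\in S}x_e\le f(S)\ \forall S\subseteq E\}$ (the convex hull of incidence vectors of independent sets), circuits taken w.r.t. this system. Transportation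 polytope: for $u\in\mathbb Z_+^m$, $v\in\mathbb Z_+^n$, the set of $y\in\mathbb R^{mn}$ with $\sum_{j=1}^n y_{ij}=u_i$ ($i=1..m$), $\sum_{i=1}^m y_{ij}=v_j$ ($j=1..n$), $y_{ij}\ge 0$. Bounded-size partition polytope: for $k$ clusters, $n$ items and $\kappa_i^-,\kappa_i^+\in\mathbb Z_+$, $PP(\kappa^\pm)$ is the set of $y\in\mathbb R^{kn}$ with $\sum_{i=1}^k y_{ij}=1$ ($j=1..n$), $\sum_{j=1}^n y_{ij}\ge\kappa_i^-$, $\sum_{j=1}^n y_{ij}\le\kappa_i^+$ ($i=1..k$), $y_{ij}\ge 0$. Fixed-size partition polytope: for $\kappa_i\in\mathbb Z_+$, $PP(\kappa)$ is the set of $y\in\mathbb R^{kn}$ with $\sum_{j=1}^n y_{ij}=\kappa_i$ ($i=1..k$), $\sum_{i=1}^k y_{ij}=1$ ($j=1..n$), $y_{ij}\ge 0$. *)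

(* Defs.v *)
From mathcomp Require Import all_boot all_order all_algebra.
From mathcomp Require Import reals.

Set Implicit Arguments.
Unset Strict Implicit.
Unset Printing Implicit Defensive.

Import Order.TTheory GRing.Theory Num.Theory.
Local Open Scope ring_scope.

(* The system  A x = b, B x <= d  in the space R^V.  Rows and columns are
   indexed by arbitrary finite types, so that a polytope whose coordinates are
   indexed by a product, or whose rows are indexed by subsets, needs no
   renumbering. *)
Record lin_system (R : realType) (V : finType) := LinSystem {
  eq_row : finType;
  le_row : finType;
  eq_mx : eq_row -> V -> rat;
  eq_rhs : eq_row -> R;
  le_mx : le_row -> V -> rat;
  le_rhs : le_row -> R
}.

Section CircuitWalks.

Variables (R : realType) (V : finType).
Implicit Types (S : lin_system R V) (x z : {ffun V -> R}) (g : {ffun V -> int}).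

Definition row_dot (a : V -> rat) x : R := \sum_e ratr (a e) * x e.

Definition in_poly S x : Prop :=
  (forall i, row_dot (eq_mx (l := S) i) x = eq_rhs i) /\
  (forall i, row_dot (le_mx (l := S) i) x <= le_rhs i).

Definition in_ker S x : Prop := forall i, row_dot (eq_mx (l := S) i) x = 0.

Definition le_supp S x : {set le_row S} :=
  [set i | row_dot (le_mx i) x != 0].

Definition int_vec g : {ffun V -> R} := [ffun e => (g e)%:~R].

(* "Coprime components" means that the gcd of all the components is 1. *)
Definition circuit S g : Prop :=
  [/\ in_ker S (int_vec g),
      int_vec g != 0,
      \big[gcdn/0%N]_(e : V) `|g e|%N = 1%N
    & forall x, in_ker S x -> x != 0 ->
        ~~ (le_supp S x \proper le_supp S (int_vec g))].

(* The nonempty faces of a polyhedron are its intersections with supporting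
   hyperplanes, together with the polyhedron itself (c = 0). *)
Definition is_face S (F : {ffun V -> R} -> Prop) : Prop :=
  exists (c : {ffun V -> R}) (delta : R),
    (forall x, in_poly S x -> \sum_e c e * x e <= delta) /\
    (forall x, F x <-> in_poly S x /\ \sum_e c e * x e = delta).

Definition vertex S x : Prop := is_face S (fun z => z = x).

Definition segment x (y : {ffun V -> R}) z : Prop :=
  exists t : R, 0 <= t <= 1 /\ z = [ffun e => (1 - t) * x e + t * y e].

(* For x != y the segment [x, y] has dimension 1, so it is an edge as soon as
   it is a face. *)
Definition edge S x (y : {ffun V -> R}) : Prop := x != y /\ is_face S (segment x y).

Definition move x (a : R) g : {ffun V -> R} :=
  [ffun e => x e + a * (g e)%:~R].

Definition maximal_step S x (y : {ffun V -> R}) : Prop :=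
  exists g (alpha : R),
    [/\ circuit S g, 0 < alpha, y = move x alpha g
      & forall a, alpha < a -> ~ in_poly S (move x a g)].

(* The walk is y 0, ..., y k; the values of y beyond k are irrelevant. *)
Definition circuit_walk S (k : nat) (y : nat -> {ffun V -> R}) : Prop :=
  [/\ vertex S (y 0%N), vertex S (y k),
      forall i, (i <= k)%N -> in_poly S (y i)
    & forall i, (i < k)%N -> maximal_step S (y i) (y i.+1)].

Definition integral_point x : Prop := forall e, x e \is a Num.int.

Definition integral_walk (k : nat) (y : nat -> {ffun V -> R}) : Prop :=
  forall i, (i <= k)%N -> integral_point (y i).

Definition vertex_walk S (k : nat) (y : nat -> {ffun V -> R}) : Prop :=
  forall i, (i <= k)%N -> vertex S (y i).

Definition edge_walk S (k : nat) (y : nat -> {ffun V -> R}) : Prop :=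
  vertex_walk S k y /\ forall i, (i < k)%N -> edge S (y i) (y i.+1).

Definition GCW S : Prop := forall x, vertex S x -> integral_point x.

Definition ICW S : Prop :=
  GCW S /\ forall k y, circuit_walk S k y -> integral_walk k y.

Definition VCW S : Prop :=
  GCW S /\ forall k y, circuit_walk S k y -> vertex_walk S k y.

Definition ECW S : Prop :=
  GCW S /\ forall k y, circuit_walk S k y -> edge_walk S k y.

End CircuitWalks.

Record matroid (E : finType) := Matroid {
  indep : {set E} -> bool;
  indep_set0 : indep set0;
  indep_sub : forall I J : {set E}, J \subset I -> indep I -> indep J;
  indep_aug : forall I J : {set E}, indep I -> indep J -> (#|I| < #|J|)%N ->
    exists2 e, e \in J :\: I & indep (e |: I)
}.

Definition matroid_rank (E : finType) (M : matroid E) (S : {set E}) : nat :=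
  (\max_(I : {set E} | (I \subset S) && indep M I) #|I|)%N.

Section Polytopes.

Variable R : realType.

(* Rows: [inl e] is  - x_e <= 0,  [inr T] is  \sum_(e in T) x_e <= f(T). *)
Definition matroid_polytope (E : finType) (M : matroid E) : lin_system R E :=
  @LinSystem R E void (E + {set E})%type
    (fun _ _ => 0) (fun _ => 0)
    (fun r e => match r with
                | inl e' => - (e' == e)%:R
                | inr T => (e \in T)%:R
                end)
    (fun r => match r with
              | inl _ => 0
              | inr T => (matroid_rank M T)%:R
              end).

(* Coordinates are the pairs (i, j).  Equality rows: [inl i] fixes
   \sum_j y_ij,  [inr j] fixes  \sum_i y_ij.  Inequality rows:  - y_ij <= 0. *)
Definition transportation (m n : nat) (u : 'I_m -> nat) (v : 'I_n -> nat) :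
    lin_system R ('I_m * 'I_n)%type :=
  @LinSystem R ('I_m * 'I_n)%type ('I_m + 'I_n)%type ('I_m * 'I_n)%type
    (fun r q => match r with
                | inl i => (q.1 == i)%:R
                | inr j => (q.2 == j)%:R
                end)
    (fun r => match r with inl i => (u i)%:R | inr j => (v j)%:R end)
    (fun p q => - (p == q)%:R)
    (fun _ => 0).

(* Inequality rows: [inl (inl i)] is  - \sum_j y_ij <= - kmin_i,
   [inl (inr i)] is  \sum_j y_ij <= kmax_i,  [inr (i, j)] is  - y_ij <= 0. *)
Definition bounded_partition (k n : nat) (kmin kmax : 'I_k -> nat) :
    lin_system R ('I_k * 'I_n)%type :=
  @LinSystem R ('I_k * 'I_n)%type 'I_n (('I_k + 'I_k) + 'I_k * 'I_n)%type
    (fun j q => (q.2 == j)%:R)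
    (fun _ => 1)
    (fun r q => match r with
                | inl (inl i) => - (q.1 == i)%:R
                | inl (inr i) => (q.1 == i)%:R
                | inr p => - (p == q)%:R
                end)
    (fun r => match r with
              | inl (inl i) => - (kmin i)%:R
              | inl (inr i) => (kmax i)%:R
              | inr _ => 0
              end).

Definition fixed_partition (k n : nat) (kappa : 'I_k -> nat) :
    lin_system R ('I_k * 'I_n)%type :=
  @transportation k n kappa (fun _ => 1%N).

(* Membership in the encoded systems is membership in the intended polytopes. *)

Lemma row_dot_delta (V : finType) (p : V) (x : {ffun V -> R}) :
  row_dot (fun q => - (p == q)%:R) x = - x p.
Proof.
rewrite /row_dot (bigD1 p) //= eqxx rmorphN rmorph1 mulN1r big1 ?addr0 //.
by move=> q /negPf; rewrite eq_sym => ->; rewrite oppr0 rmorph0 mul0r.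
Qed.

Lemma row_dot_ind (V : finType) (P : pred V) (x : {ffun V -> R}) :
  row_dot (fun q => (P q)%:R) x = \sum_(q | P q) x q.
Proof.
rewrite /row_dot [RHS]big_mkcond /=; apply: eq_bigr => q _.
by case: (P q); rewrite ?rmorph1 ?mul1r // rmorph0 mul0r.
Qed.

Lemma row_dot_opp (V : finType) (a : V -> rat) (x : {ffun V -> R}) :
  row_dot (fun q => - a q) x = - row_dot a x.
Proof.
rewrite /row_dot -sumrN; apply: eq_bigr => q _.
by rewrite rmorphN mulNr.
Qed.

Lemma row_dot_fst (m n : nat) (i : 'I_m) (y : {ffun 'I_m * 'I_n -> R}) :
  row_dot (fun q => (q.1 == i)%:R) y = \sum_(j < n) y (i, j).
Proof.
rewrite (row_dot_ind (fun q : 'I_m * 'I_n => q.1 == i)).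
transitivity (\sum_(i' < m | i' == i) \sum_(j < n) y (i', j)).
  rewrite pair_big_dep /=; apply: eq_big => [[a b]|[a b] _] //=.
  by rewrite andbT.
by rewrite big_pred1_eq.
Qed.

Lemma row_dot_snd (m n : nat) (j : 'I_n) (y : {ffun 'I_m * 'I_n -> R}) :
  row_dot (fun q => (q.2 == j)%:R) y = \sum_(i < m) y (i, j).
Proof.
rewrite (row_dot_ind (fun q : 'I_m * 'I_n => q.2 == j)).
transitivity (\sum_(i < m) \sum_(j' < n | j' == j) y (i, j')).
  by rewrite pair_big_dep /=; apply: eq_big => [[a b]|[a b] _].
by apply: eq_bigr => i _; rewrite big_pred1_eq.
Qed.

Lemma in_matroid_polytope (E : finType) (M : matroid E) (x : {ffun E -> R}) :
  in_poly (matroid_polytope M) x <->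
  (forall e, 0 <= x e) /\
  (forall S : {set E}, \sum_(e in S) x e <= (matroid_rank M S)%:R).
Proof.
split=> [[_ H]|[H1 H2]]; [split=> [e|S]|split=> [[]|[e|S]] /=].
- by have := H (inl e); rewrite /= row_dot_delta oppr_le0.
- by have := H (inr S); rewrite /= (row_dot_ind (mem S)).
- by rewrite row_dot_delta oppr_le0.
- by rewrite (row_dot_ind (mem S)); exact: H2.
Qed.

Lemma in_transportation (m n : nat) (u : 'I_m -> nat) (v : 'I_n -> nat)
    (y : {ffun 'I_m * 'I_n -> R}) :
  in_poly (transportation u v) y <->
  [/\ forall i, \sum_(j < n) y (i, j) = (u i)%:R,
      forall j, \sum_(i < m) y (i, j) = (v j)%:R
    & forall i j, 0 <= y (i, j)].
Proof.
split=> [[He Hl]|[H1 H2 H3]]; first split=> [i|j|i j].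
- by have := He (inl i); rewrite /= row_dot_fst.
- by have := He (inr j); rewrite /= row_dot_snd.
- by have := Hl (i, j); rewrite /= row_dot_delta oppr_le0.
- split=> [[i|j]|[i j]] /=; rewrite ?row_dot_fst ?row_dot_snd //.
  by rewrite row_dot_delta oppr_le0.
Qed.

Lemma in_bounded_partition (k n : nat) (kmin kmax : 'I_k -> nat)
    (y : {ffun 'I_k * 'I_n -> R}) :
  in_poly (bounded_partition n kmin kmax) y <->
  [/\ forall j, \sum_(i < k) y (i, j) = 1,
      forall i, \sum_(j < n) y (i, j) >= (kmin i)%:R,
      forall i, \sum_(j < n) y (i, j) <= (kmax i)%:R
    & forall i j, 0 <= y (i, j)].
Proof.
split=> [[He Hl]|[H1 H2 H3 H4]]; first split=> [j|i|i|i j].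
- by have := He j; rewrite /= row_dot_snd.
- have := Hl (inl (inl i)).
  by rewrite /= row_dot_opp row_dot_fst lerN2.
- by have := Hl (inl (inr i)); rewrite /= row_dot_fst.
- by have := Hl (inr (i, j)); rewrite /= row_dot_delta oppr_le0.
- split=> [j|[[i|i]|[i j]]] /=.
  + by rewrite row_dot_snd.
  + by rewrite row_dot_opp row_dot_fst lerN2.
  + by rewrite row_dot_fst.
  + by rewrite row_dot_delta oppr_le0.
Qed.

End Polytopes.

(* Main.v *)
Require Import Defs.
From mathcomp Require Import all_boot all_order all_algebra.
From mathcomp Require Import reals.
From mathcomp Require Import ring lra zify.

(* In a transportation polytope, a nonempty cell set F touching r rows and c columns
   carries a nonzero vector with vanishing row and column sums as soon as
   #|F| >= r + c.  The fractional cells of a point meet every row and column at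
   least twice or not at all, so vertices are integral; a circuit must have
   exactly two nonzero entries per row and column it touches, so its entries lie
   in {-1, 0, 1}, and maximal steps from integral points end at integral points.
   In a fixed-size partition polytope, integral points are 0/1 vertices.  For a
   maximal step from a vertex x along g, the face of the points supported in
   supp x \cup supp g only contains points x + t g, by minimality of supp g, so
   the step follows an edge.

   Counterexamples.  For the matroid on {0, 1, 2} where 0 and 1 are parallel:
     (0,0,1) -> (1/2,1/2,1/2) -> (1,0,1/2) -> (1,0,1).
   For the 2 x 3 transportation polytope with margins (3,2) and (2,1,2), the
   first row goes (2,0,1) -> (1,1,1) -> (2,1,0), where (1,1,1) is not a vertex.
   For two items and two clusters of size between 0 and 2, the polytope is a
   square, whose diagonal is a maximal circuit step. *)

Set Implicit Arguments.
Unset Strict Implicit.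
Unset Printing Implicit Defensive.

Import Order.TTheory GRing.Theory Num.Theory.
Local Open Scope ring_scope.

(** * Linear systems and circuits *)

Section Systems.
Variables (R : realType) (V : finType) (S : lin_system R V).
Implicit Types (x y z d : {ffun V -> R}) (g : {ffun V -> int}) (a : V -> rat).

Lemma row_dotD a x y : row_dot a (x + y) = row_dot a x + row_dot a y.
Proof.
by rewrite /row_dot -big_split /=; apply: eq_bigr => e _; rewrite ffunE mulrDr.
Qed.

Lemma row_dotZ a (t : R) x : row_dot a [ffun e => t * x e] = t * row_dot a x.
Proof.
by rewrite /row_dot mulr_sumr; apply: eq_bigr => e _; rewrite ffunE mulrCA.
Qed.

Lemma row_dotN a x : row_dot a (- x) = - row_dot a x.
Proof.
by rewrite /row_dot -sumrN; apply: eq_bigr => e _; rewrite ffunE mulrN.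
Qed.

Lemma row_dotB a x y : row_dot a (x - y) = row_dot a x - row_dot a y.
Proof. by rewrite row_dotD row_dotN. Qed.

Lemma vertex_in_poly x : vertex S x -> in_poly S x.
Proof. by case=> c [delta [_ H]]; case/(H x): (erefl x). Qed.

(** The linear form exposing [x] averages to [delta] over [x + d] and [x - d] without exceeding it,
    so [x + d] attains it too and must be [x]. *)
Lemma vertex_not_midpoint x d :
  vertex S x -> in_poly S (x + d) -> in_poly S (x - d) -> d = 0.
Proof.
move=> [c [delta [Hle Hx]]] Pp Pm; have [Px cx] := (Hx x).1 erefl.
have Dd y z : \sum_e c e * (y + z) e = \sum_e c e * y e + \sum_e c e * z e.
  by rewrite -big_split; apply: eq_bigr => e _; rewrite ffunE mulrDr.
have Dn y : \sum_e c e * (- y) e = - \sum_e c e * y e.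
  by rewrite -sumrN; apply: eq_bigr => e _; rewrite ffunE mulrN.
have := Hle _ Pp; have := Hle _ Pm; rewrite !Dd Dn cx => h1 h2.
have /Hx : in_poly S (x + d) /\ \sum_e c e * (x + d) e = delta.
  by split=> //; rewrite Dd cx; lra.
by move/(congr1 (fun z => z - x)); rewrite addrAC subrr add0r.
Qed.

Lemma in_poly_sub_ker x y : in_poly S x -> in_poly S y -> in_ker S (x - y).
Proof. by move=> [Hx _] [Hy _] i; rewrite row_dotB Hx Hy subrr. Qed.

Lemma in_poly_segment x y (t : R) : 0 <= t <= 1 -> in_poly S x -> in_poly S y ->
  in_poly S [ffun e => (1 - t) * x e + t * y e].
Proof.
move=> /andP[t0 t1] [Ex Lx] [Ey Ly].
have -> : [ffun e => (1 - t) * x e + t * y e]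
    = [ffun e => (1 - t) * x e] + [ffun e => t * y e].
  by apply/ffunP => e; rewrite !ffunE.
split=> i; rewrite row_dotD !row_dotZ.
  by rewrite Ex Ey -mulrDl subrK mul1r.
have -> : le_rhs i = (1 - t) * le_rhs i + t * le_rhs i by ring.
by rewrite lerD // ler_wpM2l // subr_ge0.
Qed.

(** Subtracting from [x] the multiple of [g] that cancels one row of the support leaves a kernel
    vector of strictly smaller support, hence 0 by minimality. *)
Lemma circuit_scalar g x : circuit S g -> le_supp S (int_vec R g) != set0 ->
  in_ker S x -> le_supp S x \subset le_supp S (int_vec R g) ->
  exists t : R, x = [ffun e => t * (g e)%:~R].
Proof.
move=> [Kg _ _ Mg] /set0Pn[i ig] Kx sub.
set G := int_vec R g in Kg Mg ig sub.
have ig' : row_dot (le_mx i) G != 0 by move: ig; rewrite inE.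
pose t := row_dot (le_mx i) x / row_dot (le_mx i) G.
exists t; set tg := [ffun e => _].
have tgE : tg = [ffun e => t * G e] by apply/ffunP => e; rewrite !ffunE.
apply/eqP; rewrite -subr_eq0; apply/negPn/negP => nz.
have Kd : in_ker S (x - tg).
  by move=> j; rewrite row_dotB tgE row_dotZ Kx Kg mulr0 subrr.
have /negP[] := Mg _ Kd nz; apply/properP; split.
  apply/subsetP => j; rewrite !inE row_dotB tgE row_dotZ => h.
  apply: contraNneq h => gj; rewrite gj mulr0 subr0.
  by have := subsetP sub j; rewrite !inE gj eqxx => /contraTT->.
by exists i => //; rewrite inE row_dotB tgE row_dotZ /t divfK // subrr eqxx.
Qed.

(** A nonzero kernel vector of smaller support would be a nonzero multiple of [g], whose support is
    not smaller. The unit entry settles coprimality. *)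
Lemma circuitI g e0 : in_ker S (int_vec R g) -> `|g e0|%N = 1%N ->
  (forall x, in_ker S x -> le_supp S x \subset le_supp S (int_vec R g) ->
     exists t : R, x = [ffun e => t * (g e)%:~R]) ->
  circuit S g.
Proof.
move=> Kg g1 H; split=> //.
- apply: contraTneq isT => /ffunP/(_ e0)/eqP.
  by rewrite !ffunE intr_eq0 -absz_eq0 g1.
- by rewrite (bigD1 e0) //= g1 gcd1n.
move=> x Kx nz; apply/negP => pr.
have [t xE] := H x Kx (proper_sub pr).
have t0 : t != 0.
  by apply: contraNneq nz => t0; apply/eqP/ffunP => e; rewrite xE !ffunE t0 mul0r.
move/properP: pr => [_ [i]]; rewrite !inE => ig /negP[].
have -> : x = [ffun e => t * int_vec R g e].
  by rewrite xE; apply/ffunP => e; rewrite !ffunE.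
by rewrite row_dotZ mulf_neq0.
Qed.

Lemma circuit_dvd g (d : nat) :
  circuit S g -> (forall p, (d %| `|g p|)%N) -> d = 1%N.
Proof.
move=> [_ _ g1 _] dv; apply/eqP; rewrite -dvdn1 -g1.
by apply/dvdn_biggcdP => p _.
Qed.

End Systems.

(** * Nonzero solutions of homogeneous systems with fewer equations than unknowns *)

Section Dimension.
Variables (F : fieldType) (V C : finType).

(** A matrix with more rows than columns has a nonzero left kernel vector, which is extended by 0
    outside [X]. *)
Lemma exists_nonzero_solution (a : C -> V -> F) (X : {set V}) (K : {set C}) :
  (#|K| < #|X|)%N ->
  exists x : {ffun V -> F}, [/\ x != 0, forall e, e \notin X -> x e = 0
    & forall c, c \in K -> \sum_e a c e * x e = 0].
Proof.
move=> lt; pose M : 'M[F]_(#|X|, #|K|) :=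
  \matrix_(i, j) a (enum_val j) (enum_val i).
have : kermx M != 0.
  rewrite -mxrank_eq0 mxrank_ker -lt0n subn_gt0.
  exact: leq_ltn_trans (rank_leq_col _) lt.
move=> /rowV0Pn[v /sub_kermxP vM v0].
have [e0 Xe0] : exists e, e \in X by apply/card_gt0P; exact: leq_ltn_trans lt.
pose x := [ffun e => if e \in X then v 0 (enum_rank_in Xe0 e) else 0].
exists x; split=> [|e|c cK].
- have /existsP[i vi] : [exists i, v 0 i != 0].
    apply: contraNT v0; rewrite negb_exists => /forallP h.
    by apply/eqP/rowP => i; rewrite mxE; apply/eqP; have := h i; rewrite negbK.
  apply: contraNneq vi => /ffunP/(_ (enum_val i)).
  by rewrite !ffunE enum_valP enum_valK_in => ->.
- by rewrite ffunE => /negbTE ->.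
have := congr1 (fun w : 'rV_ _ => w 0 (enum_rank_in cK c)) vM.
rewrite !mxE; apply: etrans.
rewrite (bigID (mem X)) /= [X in _ + X]big1 ?addr0 => [|e /negbTE eX]; last first.
  by rewrite ffunE eX mulr0.
rewrite big_enum_val /=; apply: eq_bigr => i _.
by rewrite ffunE enum_valP enum_valK_in mxE mulrC enum_rankK_in.
Qed.

End Dimension.

(** * Counting *)

Section Counting.

Lemma card_fibers (T U : finType) (f : T -> U) (X : {set T}) :
  #|X| = (\sum_(u in f @: X) #|[set p in X | f p == u]|)%N.
Proof.
rewrite -sum1_card (partition_big f (mem (f @: X))) => [|p pX]; last exact: imset_f.
by apply: eq_bigr => u _; rewrite -sum1_card; apply: eq_bigl => p; rewrite inE.
Qed.

Lemma mul_card_imset (T U : finType) (f : T -> U) (X : {set T}) k :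
  (forall u, u \in f @: X -> (k <= #|[set p in X | f p == u]|)%N) ->
  (#|f @: X| * k <= #|X|)%N.
Proof.
move=> h; rewrite [leqRHS](card_fibers f) -sum_nat_const.
exact: leq_sum.
Qed.

(** The fibers have at least [k] elements each and no more than [k] on average, so none can exceed
    [k]. *)
Lemma card_fiber_tight (T U : finType) (f : T -> U) (X : {set T}) k :
  (forall u, u \in f @: X -> (k <= #|[set p in X | f p == u]|)%N) ->
  (#|X| <= #|f @: X| * k)%N ->
  forall u, (#|[set p in X | f p == u]| <= k)%N.
Proof.
move=> h le u; have [uX|uX] := boolP (u \in f @: X); last first.
  rewrite (_ : [set p in X | f p == u] = set0) ?cards0 //.
  apply/setP => p; rewrite !inE; apply/negbTE/negP => /andP[pX /eqP fp].
  by move/negP: uX; apply; rewrite -fp imset_f.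
move: le; rewrite (card_fibers f) -sum_nat_const (bigD1 u) //= [leqRHS](bigD1 u) //=.
have : (\sum_(i in f @: X | i != u) k <=
        \sum_(i in f @: X | i != u) #|[set p in X | f p == i]|)%N.
  by apply: leq_sum => i /andP[/h].
lia.
Qed.

Lemma two_le_card (T : finType) (X : {set T}) a b :
  a \in X -> b \in X -> a != b -> (2 <= #|X|)%N.
Proof.
move=> aX bX ab; rewrite -[2%N](_ : #|[set a; b]| = 2%N); last by rewrite cards2 ab.
by apply/subset_leq_card/subsetP => c; rewrite !inE => /orP[] /eqP->.
Qed.

Lemma sum0_other (T : finType) (W : zmodType) (h : T -> W) j :
  \sum_k h k = 0 -> h j != 0 -> exists2 k, k != j & h k != 0.
Proof.
move=> s hj; apply/exists_inP; apply: contraNT hj => /exists_inPn no.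
move: s; rewrite (bigD1 j) //= big1 ?addr0 => [/eqP//|k kj].
by apply/eqP; have := no k kj; rewrite negbK.
Qed.

Lemma int_sum_other (T : finType) (R : realType) (h : T -> R) j :
  \sum_k h k \is a Num.int -> h j \isn't a Num.int ->
  exists2 k, k != j & h k \isn't a Num.int.
Proof.
move=> s hj; apply/exists_inP; apply: contraNT hj => /exists_inPn no.
move: s; rewrite (bigD1 j) //= => s.
rewrite -[h j](addrK (\sum_(k | k != j) h k)) rpredB // rpred_sum // => k kj.
by have := no k kj; rewrite negbK.
Qed.

(** With at most two nonzero terms and sum 0, the nonzero terms are opposite, so level [M] catches
    either both or neither. *)
Lemma sum_level (T : finType) (h : T -> int) (M : nat) :
  (0 < M)%N -> \sum_k h k = 0 -> (#|[set k | h k != 0%R]| <= 2)%N ->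
  \sum_k (if `|h k|%N == M then h k else 0) = 0.
Proof.
move=> M0 s le2.
have [/existsP[j /eqP hj]|no] := boolP [exists j, `|h j|%N == M]; last first.
  by apply: big1 => k _; case: eqP => // /eqP hk; case/negP: no; apply/existsP; exists k.
have hj0 : h j != 0 by rewrite -absz_eq0 hj -lt0n.
have [k kj hk0] := sum0_other s hj0.
have hl l : l != j -> l != k -> h l = 0.
  move=> lj lk; apply/eqP; apply: contraTT le2 => hl.
  rewrite -ltnNge -[3%N](_ : #|l |: [set k; j]| = 3%N).
    apply/subset_leq_card/subsetP => a; rewrite !inE.
    by move=> /or3P[] /eqP->.
  by rewrite cardsU1 cards2 kj !inE negb_or lj lk.
have hk : `|h k|%N = M.
  move: s; rewrite (bigD1 j) //= (bigD1 k) //= big1 ?addr0; first lia.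
  by move=> l /andP[]; exact: hl.
rewrite -[RHS]s; apply: eq_bigr => l _.
have [->|lj] := eqVneq l j; first by rewrite hj eqxx.
have [->|lk] := eqVneq l k; first by rewrite hk eqxx.
by rewrite hl // absz0 if_same.
Qed.

Lemma exists_lower_bound (R : realType) (T : finType) (X : {set T}) (b : T -> R) :
  (forall p, p \in X -> 0 < b p) ->
  exists2 eps, 0 < eps & forall p, p \in X -> eps <= b p.
Proof.
(* The default 1 keeps the minimum positive when [X] is empty. *)
move=> h; exists (\big[Order.min/1]_(p in X) b p).
  by elim/big_ind: _ => // x y x0 y0; rewrite lt_min x0.
by move=> p pX; exact: bigmin_le_cond.
Qed.

Lemma card_row_le (T U : finType) (X : {set T * U}) a :
  (#|[set b | (a, b) \in X]| <= #|[set p in X | p.1 == a]|)%N.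
Proof.
rewrite -(card_imset _ (f := pair a)) => [|b c []//].
by apply/subset_leq_card/subsetP => _ /imsetP[b + ->]; rewrite !inE eqxx andbT.
Qed.

Lemma card_col_le (T U : finType) (X : {set T * U}) b :
  (#|[set a | (a, b) \in X]| <= #|[set p in X | p.2 == b]|)%N.
Proof.
rewrite -(card_imset _ (f := fun a => (a, b))) => [|a c []//].
by apply/subset_leq_card/subsetP => _ /imsetP[a + ->]; rewrite !inE eqxx andbT.
Qed.

End Counting.

(** * Transportation polytopes *)

(** If [a] were not an integer, the longer step [Num.ceil a] would still be feasible: a decreasing
    coordinate starts at an integer that is at least [a], hence at least the ceiling. This
    contradicts maximality. *)
Lemma unit_maximal_step (R : realType) (V : finType) (S : lin_system R V)
    (x : {ffun V -> R}) (g : {ffun V -> int}) (a : R) :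
  integral_point x -> (forall p, (`|g p| <= 1)%N) -> 0 < a ->
  (forall p, 0 <= move x a g p) ->
  (forall b, (forall p, 0 <= move x b g p) -> in_poly S (move x b g)) ->
  (forall b, a < b -> ~ in_poly S (move x b g)) ->
  integral_point (move x a g).
Proof.
move=> Ix g1 a0 pos inP max.
have [aZ p|aZ] := boolP (a \is a Num.int); first by rewrite ffunE rpredD ?rpredM ?intr_int.
exfalso; apply: (max (Num.ceil a)%:~R).
  by rewrite lt_neqAle ceil_ge andbT eq_sym -intrEceil.
apply: inP => p; have := pos p; rewrite !ffunE.
have lea : a <= (Num.ceil a)%:~R by exact: ceil_ge.
have : [|| g p == 0, g p == 1 | g p == -1] by have := g1 p; lia.
move=> /or3P[] /eqP->; rewrite ?rmorphN1 ?mulr0 ?mulr1 ?mulrN1 //; first lra.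
rewrite !subr_ge0; have /intrP[k ->] := Ix p.
by rewrite ler_int -ceil_le_int.
Qed.

Section Transportation.
Variables (R : realType) (m n : nat).
Implicit Types (x z : {ffun 'I_m * 'I_n -> R}) (g : {ffun 'I_m * 'I_n -> int}).
Implicit Type X : {set 'I_m * 'I_n}.
Implicit Types (u : 'I_m -> nat) (v : 'I_n -> nat).

(** Taken over any additive group so as to cover integer circuits and real kernel vectors alike. *)
Definition balanced (W : zmodType) (z : 'I_m * 'I_n -> W) :=
  (forall i, \sum_j z (i, j) = 0) /\ (forall j, \sum_i z (i, j) = 0).

(** The property shared by the fractional cells of a point with integer margins and by the support
    of a balanced vector. *)
Definition doubly_met X :=
  (forall i j, (i, j) \in X -> exists2 j', j' != j & (i, j') \in X) /\
  (forall i j, (i, j) \in X -> exists2 i', i' != i & (i', j) \in X).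

Lemma in_ker_transportation u v z :
  in_ker (transportation R u v) z <-> balanced z.
Proof.
split=> [H|[H1 H2] [i|j]]; rewrite /= ?row_dot_fst ?row_dot_snd //.
by split=> [i|j]; [have := H (inl i)|have := H (inr j)];
  rewrite /= ?row_dot_fst ?row_dot_snd.
Qed.

Lemma le_supp_transportation u v z :
  le_supp (transportation R u v) z = [set p | z p != 0].
Proof. by apply/setP => p; rewrite !inE /= row_dot_delta oppr_eq0. Qed.

Lemma balanced_int_vec g : balanced (int_vec R g) <-> balanced g.
Proof.
have E (T : finType) (h : T -> 'I_m * 'I_n) :
    \sum_k int_vec R g (h k) = (\sum_k g (h k))%:~R.
  by rewrite rmorph_sum; apply: eq_bigr => k _; rewrite ffunE.
split=> -[H1 H2]; split=> [i|j]; last 2 first.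
- by rewrite E H1.
- by rewrite E H2.
- by apply/eqP; rewrite -(intr_eq0 R) -E H1.
- by apply/eqP; rewrite -(intr_eq0 R) -E H2.
Qed.

Lemma doubly_met_rows X : doubly_met X ->
  forall i, i \in fst @: X -> (2 <= #|[set p in X | p.1 == i]|)%N.
Proof.
move=> [H _] i /imsetP[[i0 j] pX /= ->]; have [j' jj' p'X] := H _ _ pX.
by apply: (two_le_card (a := (i0, j')) (b := (i0, j)));
  rewrite ?inE ?p'X ?pX ?eqxx // xpair_eqE eqxx.
Qed.

Lemma doubly_met_cols X : doubly_met X ->
  forall j, j \in snd @: X -> (2 <= #|[set p in X | p.2 == j]|)%N.
Proof.
move=> [_ H] j /imsetP[[i j0] pX /= ->]; have [i' ii' p'X] := H _ _ pX.
by apply: (two_le_card (a := (i', j0)) (b := (i, j0)));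
  rewrite ?inE ?p'X ?pX ?eqxx // xpair_eqE eqxx andbT.
Qed.

Lemma doubly_met_card X :
  doubly_met X -> (#|fst @: X| + #|snd @: X| <= #|X|)%N.
Proof.
move=> dX; have := mul_card_imset (doubly_met_cols dX).
have := mul_card_imset (doubly_met_rows dX).
set a := #|_|; set b := #|_|; set c := #|_|; lia.
Qed.

(* The row equations and the column equations have equal sums, so one of them
   can be dropped: fewer equations than unknowns remain. *)
Lemma exists_balanced X :
  X != set0 -> (#|fst @: X| + #|snd @: X| <= #|X|)%N ->
  exists z, [/\ z != 0, forall p, p \notin X -> z p = 0 & balanced z].
Proof.
move=> /set0Pn[p0 p0X] le.
pose K : {set 'I_m + 'I_n} := (inl @: (fst @: X)) :|: (inr @: ((snd @: X) :\ p0.2)).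
pose S := transportation R (fun _ : 'I_m => 0%N) (fun _ : 'I_n => 0%N).
have ltK : (#|K| < #|X|)%N.
  apply: leq_ltn_trans (leq_card_setU _ _) _.
  rewrite (card_imset _ (f := inl)) => [|? ? []//].
  rewrite (card_imset _ (f := inr)) => [|? ? []//].
  have := cardsD1 p0.2 (snd @: X); rewrite imset_f // => e.
  by apply: leq_trans le; rewrite e addnCA add1n.
pose a (c : 'I_m + 'I_n) (p : 'I_m * 'I_n) : R := ratr (Defs.eq_mx (l := S) c p).
have [z [z0 zX zK]] := exists_nonzero_solution a ltK.
have rows i : \sum_j z (i, j) = 0.
  have [iX|iX] := boolP (i \in fst @: X).
    rewrite -row_dot_fst; apply: (zK (inl i)).
    by rewrite inE imset_f.
  apply: big1 => j _; apply: zX; apply: contra iX => pX.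
  by apply/imsetP; exists (i, j).
have cols j : j != p0.2 -> \sum_i z (i, j) = 0.
  move=> jp; have [jX|jX] := boolP (j \in snd @: X).
    rewrite -row_dot_snd; apply: (zK (inr j)).
    by rewrite inE [X in _ || X]imset_f ?orbT // in_setD1 jp.
  apply: big1 => i _; apply: zX; apply: contra jX => pX.
  by apply/imsetP; exists (i, j).
exists z; split=> //; split=> // j; have [->|] := eqVneq j p0.2; last exact: cols.
(* The omitted column sums to 0 because the total and all other columns do. *)
have : \sum_j \sum_i z (i, j) = 0 by rewrite exchange_big big1.
rewrite (bigD1 p0.2) //= [X in _ + X]big1 ?addr0 => [//|j' jj']; exact: cols.
Qed.

Lemma move_in_transportation u v x (a : R) g :
  in_poly (transportation R u v) x -> balanced g ->
  (forall p, 0 <= move x a g p) -> in_poly (transportation R u v) (move x a g).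
Proof.
move=> /in_transportation[H1 H2 _] [g1 g2] pos.
have E (T : finType) (h : T -> 'I_m * 'I_n) :
    \sum_k g (h k) = 0 -> \sum_k move x a g (h k) = \sum_k x (h k).
  move=> s; under eq_bigr do rewrite ffunE.
  by rewrite big_split /= -mulr_sumr -rmorph_sum /= s mulr0 addr0.
by apply/in_transportation; split=> *; rewrite ?E.
Qed.

(** The fractional cells would carry a nonzero balanced [z], and a small multiple of it could be
    both added to and subtracted from the vertex. *)
Lemma transportation_GCW (u : 'I_m -> nat) (v : 'I_n -> nat) :
  GCW (transportation R u v).
Proof.
move=> x vx; pose X := [set p | x p \isn't a Num.int].
have Px := vertex_in_poly vx; have [H1 H2 pos] := (in_transportation _ _ _).1 Px.
have [X0|X0] := eqVneq X set0.
  move=> p; have /setP/(_ p) := X0; rewrite !inE => /negbT; by rewrite negbK.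
exfalso.
have dX : doubly_met X.
  split=> i j; rewrite inE.
    move=> /(@int_sum_other _ _ (fun j => x (i, j)))[|j' jj' ?]; last first.
      by exists j' => //; rewrite inE.
    by rewrite H1 natr_int.
  move=> /(@int_sum_other _ _ (fun i => x (i, j)))[|i' ii' ?]; last first.
    by exists i' => //; rewrite inE.
  by rewrite H2 natr_int.
have [|z [z0 zX [zr zc]]] := exists_balanced X0.
  exact: doubly_met_card.
(* This bound gives [eps * |z p| <= x p] on [X]; the added 1 keeps the denominator positive where
   [z] vanishes. *)
have [|eps e0 he] := @exists_lower_bound R _ X (fun p => x p / (1 + `|z p|)).
  move=> p; rewrite inE => xp; rewrite divr_gt0 ?ltr_pwDl //.
  rewrite lt_neqAle; case: p xp => i j xp; rewrite pos andbT.
  by apply: contraNneq xp => <-.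
have inP (d : {ffun 'I_m * 'I_n -> R}) : balanced d ->
    (forall p, `|d p| <= eps * `|z p|) ->
    in_poly (transportation R u v) (x + d).
  move=> [dr dc] dle; apply/in_transportation; split=> [i|j|i j].
  - by under eq_bigr do rewrite ffunE; rewrite big_split /= H1 dr addr0.
  - by under eq_bigr do rewrite ffunE; rewrite big_split /= H2 dc addr0.
  rewrite ffunE; have {dle} := dle (i, j).
  have [iX|iX] := boolP ((i, j) \in X); last first.
    by rewrite zX // normr0 mulr0 normr_le0 => /eqP ->; rewrite addr0.
  have := he _ iX; rewrite ler_pdivlMr ?ltr_pwDl // mulrDr mulr1.
  have := ler_norm (- d (i, j)); rewrite normrN; lra.
pose d : {ffun 'I_m * 'I_n -> R} := [ffun p => eps * z p].
have d0 : d = 0.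
  apply: (vertex_not_midpoint vx); apply: inP.
  - split=> [i|j]; under eq_bigr do rewrite ffunE; rewrite -mulr_sumr.
      by rewrite zr mulr0.
    by rewrite zc mulr0.
  - by move=> p; rewrite ffunE normrM (gtr0_norm e0).
  - split=> [i|j]; under eq_bigr do rewrite !ffunE; rewrite sumrN -mulr_sumr.
      by rewrite zr mulr0 oppr0.
    by rewrite zc mulr0 oppr0.
  - by move=> p; rewrite !ffunE normrN normrM (gtr0_norm e0).
move/negP: z0; apply; apply/eqP/ffunP => p; rewrite ffunE.
have /ffunP/(_ p) := d0; rewrite !ffunE => /eqP.
by rewrite mulf_eq0 (gt_eqF e0) => /eqP.
Qed.

(** * Supports and entries of transportation circuits *)

Lemma doubly_met_supp g : balanced g -> doubly_met [set p | g p != 0].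
Proof.
move=> [gr gc]; split=> i j; rewrite inE => nz.
  have [j' jj' nz'] := sum0_other (h := fun j => g (i, j)) (gr i) nz.
  by exists j'; rewrite ?inE.
have [i' ii' nz'] := sum0_other (h := fun i => g (i, j)) (gc j) nz.
by exists i'; rewrite ?inE.
Qed.

Lemma circuit_balanced u v g : circuit (transportation R u v) g -> balanced g.
Proof. by case=> /in_ker_transportation/balanced_int_vec. Qed.

Lemma supp_int_vec u v g :
  le_supp (transportation R u v) (int_vec R g) = [set p | g p != 0].
Proof.
by rewrite le_supp_transportation; apply/setP => p; rewrite !inE ffunE intr_eq0.
Qed.

Lemma circuit_supp_neq0 u v g :
  circuit (transportation R u v) g -> [set p | g p != 0] != set0.
Proof.
move=> [_ + _ _]; apply: contraNneq => /setP g0; apply/eqP/ffunP => p.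
by have := g0 p; rewrite !ffunE !inE => /negbT; rewrite negbK => /eqP->.
Qed.

(** With more cells than this, the support minus one cell would still carry a nonzero balanced
    vector, against minimality. *)
Lemma circuit_supp_card u v g : circuit (transportation R u v) g ->
  let X := [set p | g p != 0%R] in is_true (#|X| <= #|fst @: X| + #|snd @: X|)%N.
Proof.
move=> cg X; rewrite leqNgt; apply/negP => lt.
have bal := circuit_balanced cg; have [_ _ _ min] := cg.
have [p pX] := set0Pn _ (circuit_supp_neq0 cg); rewrite -/X in pX.
have X2 : (2 <= #|X|)%N.
  case: p pX => i j pX; have [j' jj' p'X] := (doubly_met_supp bal).1 _ _ pX.
  apply: (two_le_card p'X pX); first by rewrite xpair_eqE eqxx.
have cX : #|X| = #|X :\ p|.+1 by rewrite (cardsD1 p) pX.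
have [||z [z0 zX bz]] := @exists_balanced (X :\ p).
- by rewrite -card_gt0 -ltnS -cX.
- rewrite -ltnS -cX; apply: leq_ltn_trans lt.
  by rewrite leq_add // subset_leq_card // imsetS // subD1set.
have /min/(_ z0)/negP[] : in_ker (transportation R u v) z.
  exact/in_ker_transportation.
rewrite le_supp_transportation supp_int_vec.
apply: (@sub_proper_trans _ _ (X :\ p)); last exact: properD1.
by apply/subsetP => q; rewrite inE; apply: contraR => /zX->.
Qed.

(* A circuit has exactly two nonzero entries in every row and column it meets,
   and they are opposite.  Hence the entries of a given absolute value form a
   balanced vector by themselves, so by minimality of the support they are all
   the nonzero entries, and coprimality makes that absolute value 1. *)
Lemma transportation_circuit_unit u v g p :
  circuit (transportation R u v) g -> (`|g p| <= 1)%N.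
Proof.
move=> cg; have bal := circuit_balanced cg; have [gr gc] := bal.
pose X := [set p | g p != 0].
have dX : doubly_met X by exact: doubly_met_supp.
have hr := doubly_met_rows dX; have hc := doubly_met_cols dX.
have := circuit_supp_card cg; rewrite -/X /= => le.
(* If [X] meets r rows and c columns, [#|X| <= r + c] and [2c <= #|X|] give [#|X| <= 2r], so every
   row is tight; columns are symmetric. *)
have r2 : forall i, (#|[set p in X | p.1 == i]| <= 2)%N.
  apply: (card_fiber_tight hr); move: le (mul_card_imset hc).
  set a := #|_|; set b := #|_|; set c := #|_|; lia.
have c2 : forall j, (#|[set p in X | p.2 == j]| <= 2)%N.
  apply: (card_fiber_tight hc); move: le (mul_card_imset hr).
  set a := #|_|; set b := #|_|; set c := #|_|; lia.
have [->|gp] := eqVneq (g p) 0; first by rewrite absz0.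
pose M := `|g p|%N; have M0 : (0 < M)%N by rewrite lt0n absz_eq0.
pose h : {ffun 'I_m * 'I_n -> int} := [ffun q => if `|g q|%N == M then g q else 0].
have bh : balanced h.
  split=> [i|j]; under eq_bigr do rewrite ffunE.
    apply: (sum_level (h := fun j => g (i, j))) => //.
    apply: leq_trans (r2 i); apply: leq_trans (card_row_le _ _).
    by apply/subset_leq_card/subsetP => k; rewrite !inE.
  apply: (sum_level (h := fun i => g (i, j))) => //.
  apply: leq_trans (c2 j); apply: leq_trans (card_col_le _ _).
  by apply/subset_leq_card/subsetP => k; rewrite !inE.
have [|||t /ffunP ht] := @circuit_scalar _ _ _ g (int_vec R h) cg.
- by rewrite supp_int_vec (circuit_supp_neq0 cg).
- exact/in_ker_transportation/balanced_int_vec.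
- rewrite !supp_int_vec; apply/subsetP => q; rewrite !inE ffunE.
  by case: ifP => // _; rewrite eqxx.
have t0 : t != 0.
  have := ht p; rewrite !ffunE eqxx => e.
  by apply: contraNneq gp => t0; rewrite -(intr_eq0 R) e t0 mul0r.
(* As a nonzero multiple of [g], [h] has the same zeros, so every entry of [g] is 0 or has absolute
   value [M]. *)
have lev q : (M %| `|g q|)%N.
  have := ht q; rewrite !ffunE; case: eqP => [->//|_ /eqP].
  by rewrite eq_sym mulf_eq0 (negbTE t0) intr_eq0 /= => /eqP->; rewrite absz0 dvdn0.
by rewrite -/M (circuit_dvd cg lev).
Qed.

Lemma transportation_maximal_step u v x y :
  in_poly (transportation R u v) x -> integral_point x ->
  in_poly (transportation R u v) y -> maximal_step (transportation R u v) x y ->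
  integral_point y.
Proof.
move=> Px Ix Py [g [a [cg a0 yE max]]]; rewrite yE in Py *.
apply: unit_maximal_step max => //.
- by move=> p; exact: transportation_circuit_unit cg.
- by move=> [i j]; have [_ _] := (in_transportation _ _ _).1 Py.
- by move=> b; exact: move_in_transportation Px (circuit_balanced cg).
Qed.

Lemma transportation_ICW u v : ICW (transportation R u v).
Proof.
split; first exact: transportation_GCW.
move=> k y [v0 _ Py st]; elim=> [|i IH] ik; first exact: transportation_GCW v0.
by apply: transportation_maximal_step (st i ik); auto using ltnW.
Qed.

End Transportation.

(** * Fixed-size partition polytopes *)

Lemma sum_le_eq (R : realType) (T : finType) (a b : T -> R) :
  (forall p, a p <= b p) -> \sum_p a p = \sum_p b p -> forall p, a p = b p.
Proof.
move=> le e p; apply/esym/eqP; rewrite -subr_eq0; apply/eqP.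
apply: (psumr_eq0P (P := xpredT) (F := fun p => b p - a p)) => //.
  by move=> q _; rewrite subr_ge0.
by rewrite sumrB e subrr.
Qed.

Section ColumnStochastic.
Variables (R : realType) (k n : nat).
Implicit Types (x z : {ffun 'I_k * 'I_n -> R}) (g : {ffun 'I_k * 'I_n -> int}).

(** The constraints common to the fixed-size partition polytopes and to the bounded-size example
    below. *)
Definition column_stochastic z :=
  (forall j, \sum_i z (i, j) = 1) /\ (forall p, 0 <= z p).

Lemma column_stochastic_le1 z p : column_stochastic z -> z p <= 1.
Proof.
case: p => i j [s pos]; rewrite -(s j) (bigD1 i) //= lerDl.
by apply: sumr_ge0.
Qed.

Lemma column_stochastic_sum z : column_stochastic z -> \sum_p z p = n%:R.
Proof.
move=> [s _]; transitivity (\sum_j \sum_i z (i, j)).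
  rewrite exchange_big pair_big_dep /=.
  by apply: eq_big => [[]|[]].
by under eq_bigr do rewrite s; rewrite sumr_const card_ord.
Qed.

Lemma integral_01 z p : column_stochastic z -> integral_point z ->
  (z p == 0) || (z p == 1).
Proof.
move=> sz Iz; have := column_stochastic_le1 p sz; have := sz.2 p.
have /intrP[b ->] := Iz p.
rewrite ler0z -[1]/(1%:~R) ler_int eqr_int intr_eq0; lia.
Qed.

(** A 0/1 point [x] is exposed by its own scalar product: the value [n] at [z] forces [x p * z p] to
    equal both [x p] and [z p]. *)
Lemma integral_vertex (S : lin_system R ('I_k * 'I_n)%type) x :
  (forall z, in_poly S z -> column_stochastic z) ->
  in_poly S x -> integral_point x -> vertex S x.
Proof.
move=> H Px Ix; have sx := H _ Px.
have le z : in_poly S z -> forall p, x p * z p <= x p.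
  move=> /H sz p; rewrite -[leRHS]mulr1 ler_wpM2l ?sx.2 //.
  exact: column_stochastic_le1.
have xx p : x p * x p = x p.
  by case/orP: (integral_01 p sx Ix) => /eqP->; rewrite ?mulr0 ?mulr1.
exists x, n%:R; split=> [z Pz|z].
  by rewrite -(column_stochastic_sum sx) ler_sum // => p _; exact: le.
split=> [->|[Pz cz]].
  by split=> //; rewrite -(column_stochastic_sum sx); apply: eq_bigr => p _.
have sz := H _ Pz.
have e1 := sum_le_eq (le z Pz) (etrans cz (esym (column_stochastic_sum sx))).
have e2 : forall p, x p * z p = z p.
  apply: sum_le_eq; last by rewrite cz column_stochastic_sum.
  by move=> p; rewrite -[leRHS]mul1r ler_wpM2r ?sz.2 // column_stochastic_le1.
by apply/ffunP => p; rewrite -e2 e1.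
Qed.

Lemma fixed_partition_stochastic (kappa : 'I_k -> nat) z :
  in_poly (fixed_partition R n kappa) z -> column_stochastic z.
Proof. by move=> /in_transportation[_ ? ?]; split=> // -[i j]. Qed.

Lemma fixed_partition_edge (kappa : 'I_k -> nat) x y :
  in_poly (fixed_partition R n kappa) x -> integral_point x ->
  in_poly (fixed_partition R n kappa) y ->
  maximal_step (fixed_partition R n kappa) x y ->
  edge (fixed_partition R n kappa) x y.
Proof.
set S := fixed_partition R n kappa.
move=> Px Ix Py [g [a [cg a0 yE max]]].
have [gr gc] := circuit_balanced cg.
have [p0 gp0] := set0Pn _ (circuit_supp_neq0 cg); rewrite inE in gp0.
have sx := fixed_partition_stochastic Px; have sy := fixed_partition_stochastic Py.
have yp p : y p = x p + a * (g p)%:~R by rewrite yE ffunE.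
have x01 p := integral_01 p sx Ix.
have g_ge0 p : x p = 0 -> 0 <= g p.
  by move=> xp; have := sy.2 p; rewrite yp xp add0r pmulr_rge0 // ler0z.
split.
  apply: contraNneq gp0 => xy; have := yp p0; rewrite -xy.
  move/eqP; rewrite -subr_eq0 opprD addNKr oppr_eq0 mulf_eq0 intr_eq0.
  by rewrite (gt_eqF a0).
(* As all coordinates of a point sum to [n], the indicator of the joint support attains its bound
   [n] exactly at the points vanishing outside that support. *)
pose c : {ffun 'I_k * 'I_n -> R} := [ffun p => ((x p != 0) || (g p != 0))%:R].
have cle z : column_stochastic z -> forall p, c p * z p <= z p.
  by move=> sz p; rewrite ffunE; case: (_ || _); rewrite ?mul1r ?mul0r ?sz.2.
have csupp z : column_stochastic z -> (\sum_p c p * z p = n%:R <->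
    forall p, x p = 0 -> g p = 0 -> z p = 0).
  move=> sz; split=> [e p xp gp|h].
    have := sum_le_eq (cle z sz) (etrans e (esym (column_stochastic_sum sz))) p.
    by rewrite ffunE xp gp !eqxx mul0r.
  rewrite -(column_stochastic_sum sz); apply: eq_bigr => p _; rewrite ffunE.
  case: eqP => [xp|_]; last by rewrite mul1r.
  case: eqP => [gp|_]; last by rewrite mul1r.
  by rewrite mul0r h.
exists c, n%:R; split=> [z Pz|z].
  have sz := fixed_partition_stochastic Pz.
  by rewrite -(column_stochastic_sum sz) ler_sum // => p _; exact: cle.
split=> [[t [t01 zE]]|[Pz cz]].
  have Pz : in_poly S z by rewrite zE; exact: in_poly_segment.
  split=> //; apply/(csupp z (fixed_partition_stochastic Pz)) => p xp gp.
  by rewrite zE ffunE yp xp gp; ring.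
have sz := fixed_partition_stochastic Pz; move/(csupp z sz): cz => zsupp.
(* If [x p = 1], then [x] is 0 in the rest of the column, so [g] is nonnegative there with sum 0 and
   vanishes; hence [z] vanishes there too and [z p = 1]. *)
have eq_off p : g p = 0 -> z p = x p.
  case: p => i j gp; case/orP: (x01 (i, j)) => /eqP xp; first by rewrite xp zsupp.
  have xo i' : i' != i -> x (i', j) = 0.
    move=> ii; apply/eqP; case/orP: (x01 (i', j)) => // /eqP xi.
    have := sx.1 j; rewrite (bigD1 i) //= (bigD1 i') //= xp xi.
    have : 0 <= \sum_(l | (l != i) && (l != i')) x (l, j) by apply: sumr_ge0 => *; exact: sx.2.
    lra.
  have go i' : i' != i -> g (i', j) = 0.
    move: i'; apply: psumr_eq0P => [i' /xo/g_ge0//|].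
    by have := gc j; rewrite (bigD1 i) //= gp add0r.
  rewrite xp; have := sz.1 j; rewrite (bigD1 i) //= big1 ?addr0 // => i' ii.
  by apply: zsupp; [exact: xo|exact: go].
have [|||t zt] := @circuit_scalar _ _ _ g (z - x) cg.
- by rewrite supp_int_vec (circuit_supp_neq0 cg).
- exact: in_poly_sub_ker.
- rewrite le_supp_transportation supp_int_vec; apply/subsetP => p; rewrite !inE.
  by apply: contraNN => /eqP/eq_off zp; rewrite !ffunE zp subrr.
have zE p : z p = x p + t * (g p)%:~R.
  by have /ffunP/(_ p) := zt; rewrite !ffunE => <-; rewrite addrC subrK.
(* A positive entry of [g] lies where [x] is 0, since [y] would exceed 1 otherwise; there [z >= 0]
   forces [t >= 0]. *)
have t0 : 0 <= t.
  have [i [j gij]] : exists i j, 0 < g (i, j).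
    case: p0 gp0 => i0 j gp; case: (ltgtP (g (i0, j)) 0) gp => // [gn|gp] _.
      have [i ip|no] := pickP (fun i => 0 < g (i, j)); first by exists i, j.
      have := gc j; rewrite (bigD1 i0) //= => e.
      have : \sum_(i | i != i0) g (i, j) <= 0.
        by apply: sumr_le0 => i _; rewrite leNgt no.
      lra.
    by exists i0, j.
  have xij : x (i, j) = 0.
    case/orP: (x01 (i, j)) => /eqP // xij.
    have := column_stochastic_le1 (i, j) sy; rewrite yp xij gerDl.
    by rewrite pmulr_rle0 // lerz0 leNgt gij.
  by have := sz.2 (i, j); rewrite zE xij add0r pmulr_lge0 // ltr0z.
have ta : t <= a.
  rewrite leNgt; apply/negP => /max; apply.
  by rewrite (_ : move x t g = z) //; apply/ffunP => p; rewrite ffunE zE.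
exists (t / a); split.
  by rewrite ler_pdivrMr // mul1r ta andbT divr_ge0 // ltW.
apply/ffunP => p; rewrite ffunE zE yp; field; exact: lt0r_neq0.
Qed.

Lemma fixed_partition_ECW (kappa : 'I_k -> nat) : ECW (fixed_partition R n kappa).
Proof.
have [gcw icw] := transportation_ICW R kappa (fun _ : 'I_n => 1%N).
split=> // l y walk; have int := icw _ _ walk; case: walk => [_ _ Py st].
split=> [i il|i il].
  apply: integral_vertex (Py i il) (int i il).
  exact: fixed_partition_stochastic.
by apply: fixed_partition_edge (st i il); auto using ltnW.
Qed.

End ColumnStochastic.

(** * A matroid polytope *)

(** Case analysis phrased with [lift], the form of index that [big_ord_recl] produces. *)
Lemma forall_ordS n (P : 'I_n.+1 -> Prop) :
  P ord0 -> (forall i, P (lift ord0 i)) -> forall i, P i.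
Proof. by move=> P0 PS i; case: (unliftP ord0 i) => [j ->|->]. Qed.

Section ParallelPair.

Local Notation e0 := (ord0 : 'I_3).
Local Notation e1 := (lift ord0 ord0 : 'I_3).
Local Notation e2 := (lift ord0 (lift ord0 ord0) : 'I_3).

Lemma card_ord3 (X : {set 'I_3}) :
  #|X| = ((e0 \in X) + (e1 \in X) + (e2 \in X))%N.
Proof.
rewrite -sum1_card big_mkcond !big_ord_recl big_ord0 /=.
by do 3 case: (_ \in X).
Qed.

Lemma forall_ord3 (P : 'I_3 -> Prop) : P e0 -> P e1 -> P e2 -> forall i, P i.
Proof. by move=> *; do 3 apply: forall_ordS => //; case. Qed.

(** The graphic matroid of two parallel edges and a bridge. *)
Definition parallel_indep (I : {set 'I_3}) := ~~ ((e0 \in I) && (e1 \in I)).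

Lemma parallel_indep0 : parallel_indep set0.
Proof. by rewrite /parallel_indep inE. Qed.

Lemma parallel_indep_sub (I J : {set 'I_3}) :
  J \subset I -> parallel_indep I -> parallel_indep J.
Proof.
by move=> /subsetP s; apply: contra => /andP[/s -> /s ->].
Qed.

Lemma parallel_indep_aug (I J : {set 'I_3}) :
  parallel_indep I -> parallel_indep J -> (#|I| < #|J|)%N ->
  exists2 e, e \in J :\: I & parallel_indep (e |: I).
Proof.
rewrite /parallel_indep !card_ord3 => iI iJ lt.
have : [|| (e2 \in J) && (e2 \notin I),
    [&& e0 \in J, e0 \notin I & e1 \notin I]
  | [&& e1 \in J, e0 \notin I & e1 \notin I]].
  move: iI iJ lt.
  by do 3 case: (_ \in I); do 3 case: (_ \in J).
case/or3P => [/andP[j i]|/and3P[j i i']|/and3P[j i i']];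
  [exists e2|exists e0|exists e1]; rewrite !inE ?j ?i ?i' //=.
by rewrite (negbTE i).
Qed.

Definition parallel_matroid :=
  Matroid parallel_indep0 parallel_indep_sub parallel_indep_aug.

Variable R : realType.
Local Notation P := (matroid_polytope R parallel_matroid).
Implicit Types (x : {ffun 'I_3 -> R}).

Lemma sum_set3 (W : pzRingType) (T : {set 'I_3}) (x : {ffun 'I_3 -> W}) :
  \sum_(e in T) x e =
  (e0 \in T)%:R * x e0 + (e1 \in T)%:R * x e1 + (e2 \in T)%:R * x e2.
Proof.
rewrite big_mkcond !big_ord_recl big_ord0 /= addr0 addrA.
by do 3 (case: (_ \in T)); rewrite ?mul1r ?mul0r.
Qed.

(** The polytope is a prism, triangle times interval: the ranks of {0, 1} and {2} already imply the
    other rank bounds. *)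
Lemma in_parallel x : in_poly P x <->
  [/\ 0 <= x e0, 0 <= x e1, 0 <= x e2, x e0 + x e1 <= 1 & x e2 <= 1].
Proof.
split=> [/in_matroid_polytope[pos H]|[x0 x1 x2 x01 x2']].
  split=> //.
    have := H [set e0; e1]; rewrite sum_set3 !inE /= !mul1r mul0r addr0.
    move/le_trans; apply; rewrite (ler_nat _ _ 1); apply/bigmax_leqP => I /andP[/subsetP s].
    rewrite /= /parallel_indep card_ord3 => iI.
    have -> : (e2 \in I) = false by apply/negP => /s; rewrite !inE.
    by move: iI; do 2 case: (_ \in I).
  have := H [set e2]; rewrite big_set1.
  move/le_trans; apply; rewrite (ler_nat _ _ 1); apply/bigmax_leqP => I /andP[/subset_leq_card].
  by rewrite cards1.
apply/in_matroid_polytope; split=> [|T]; first exact: forall_ord3.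
(* A basis of [T]: drop 1 if 0 is present. *)
pose I := [set i in T | (i == e1) ==> (e0 \notin T)].
apply: (@le_trans _ _ (#|I|%:R)); last first.
  rewrite ler_nat; apply: (leq_bigmax_cond (F := fun I : {set 'I_3} => #|I|)).
  rewrite /= /parallel_indep !inE /=; apply/andP; split.
    by apply/subsetP => i; rewrite inE => /andP[].
  by case: (e0 \in T); rewrite ?andbF.
rewrite sum_set3 card_ord3 !inE /= !andbT.
by do 3 (case: (_ \in T)); rewrite /= ?mul1r ?mul0r; lra.
Qed.

Lemma parallel_GCW : GCW P.
Proof.
move=> x vx; have /in_parallel[x0 x1 x2 x01 x2'] := vertex_in_poly vx.
have fix_ (a b c : R) : 
    in_poly P (x + [ffun i : 'I_3 => nth 0 [:: a; b; c] i]) ->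
    in_poly P (x - [ffun i : 'I_3 => nth 0 [:: a; b; c] i]) ->
    [/\ a = 0, b = 0 & c = 0].
  move=> h1 h2; have /ffunP d0 := vertex_not_midpoint vx h1 h2.
  by have := (d0 e0, d0 e1, d0 e2); rewrite !ffunE /= => -[[-> ->] ->].
(* A coordinate strictly between 0 and 1 can move by [u] both ways, which [fix_] forbids when
   nothing else blocks it. *)
have mid (t : R) : 0 <= t -> t <= 1 -> (t = 0 \/ t = 1) \/ exists2 u, 0 < u & u <= t /\ t + u <= 1.
  move=> t0 t1; have [->|tn0] := eqVneq t 0; first by left; left.
  have [->|tn1] := eqVneq t 1; first by left; right.
  have t0' : 0 < t by rewrite lt_neqAle eq_sym tn0.
  have t1' : t < 1 by rewrite lt_neqAle tn1.
  right; exists (Num.min t (1 - t)); rewrite ?lt_min ?subr_gt0 ?t0' //.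
  split; first by rewrite ge_min lexx.
  by rewrite -lerBrDl ge_min lexx orbT.
have I2 : x e2 \is a Num.int.
  case: (mid _ x2 x2') => [[]->//|[u u0 [u1 u2]]].
  have [||_ _ u00] := fix_ 0 0 u; rewrite ?in_parallel ?ffunE /=; try (split; lra).
  by rewrite u00 ltxx in u0.
have [x1z|x1n] := eqVneq (x e1) 0.
  suff: x e0 \is a Num.int by move=> I0; apply: forall_ord3; rewrite ?x1z.
  have le1 : x e0 <= 1 by lra.
  case: (mid _ x0 le1) => [[]->//|[u u0 [u1 u2]]].
  have [||u00 _ _] := fix_ u 0 0; rewrite ?in_parallel ?ffunE /=; try (split; lra).
  by rewrite u00 ltxx in u0.
have [x0z|x0n] := eqVneq (x e0) 0.
  suff: x e1 \is a Num.int by move=> I0; apply: forall_ord3; rewrite ?x0z.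
  have le1 : x e1 <= 1 by lra.
  case: (mid _ x1 le1) => [[]->//|[u u0 [u1 u2]]].
  have [||_ u00 _] := fix_ 0 u 0; rewrite ?in_parallel ?ffunE /=; try (split; lra).
  by rewrite u00 ltxx in u0.
have p0 : 0 < x e0 by rewrite lt_neqAle eq_sym x0n.
have p1 : 0 < x e1 by rewrite lt_neqAle eq_sym x1n.
(* When both parallel coordinates are positive, shifting [u] between them preserves their sum. *)
pose u := Num.min (x e0) (x e1).
have u0 : 0 < u by rewrite lt_min p0.
have ux0 : u <= x e0 by rewrite ge_min lexx.
have ux1 : u <= x e1 by rewrite ge_min lexx orbT.
have [||u00 _ _] := fix_ u (- u) 0; rewrite ?in_parallel ?ffunE /=; try (split; lra).
by rewrite u00 ltxx in u0.
Qed.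

Definition vec3 (W : Type) (a b c : W) : {ffun 'I_3 -> W} :=
  [ffun i : 'I_3 => nth a [:: a; b; c] i].

(** Containment of supports means that [x] vanishes on each coordinate and subset sum on which [g]
    does. Two independent such conditions confine [x] to a line. *)
Lemma parallel_circuit (g : {ffun 'I_3 -> int}) i :
  `|g i|%N = 1%N ->
  (forall x, (forall e, g e = 0 -> x e = 0) ->
     (forall T : {set 'I_3}, \sum_(e in T) g e = 0 -> \sum_(e in T) x e = 0) ->
     exists t, x = [ffun e => t * (g e)%:~R]) ->
  circuit P g.
Proof.
move=> gi H; apply: (circuitI _ gi) => [[]|x _ /subsetP sub].
apply: H => [e ge|T gT].
  apply/eqP; have := sub (inl e); rewrite !inE /= !row_dot_delta !oppr_eq0 ffunE.
  by rewrite ge eqxx; case: eqP => // _ /(_ isT).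
apply/eqP; have := sub (inr T); rewrite !inE /= !(row_dot_ind (mem T)).
rewrite (_ : \sum_(e in T) int_vec R g e = (\sum_(e in T) g e)%:~R); last first.
  by rewrite rmorph_sum; apply: eq_bigr => e _; rewrite ffunE.
by rewrite gT eqxx; case: eqP => // _ /(_ isT).
Qed.

Lemma circuit_11N : circuit P (vec3 1 1 (-1)).
Proof.
apply: (parallel_circuit (i := e0)); rewrite ?ffunE // => x _ xT.
have := (xT [set e0; e2], xT [set e1; e2]).
rewrite !sum_set3 !inE !ffunE /=.
move=> [/(_ erefl) h1 /(_ erefl) h2].
exists (- x e2); apply/ffunP; apply: forall_ord3; rewrite !ffunE /=; lra.
Qed.

Lemma circuit_1N0 : circuit P (vec3 1 (-1) 0).
Proof.
apply: (parallel_circuit (i := e0)); rewrite ?ffunE // => x xe xT.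
have := (xT [set e0; e1], xe e2).
rewrite !sum_set3 !inE !ffunE /=.
move=> [/(_ erefl) h1 /(_ erefl) h2].
exists (x e0); apply/ffunP; apply: forall_ord3; rewrite !ffunE /=; lra.
Qed.

Lemma circuit_001 : circuit P (vec3 0 0 1).
Proof.
apply: (parallel_circuit (i := e2)); rewrite ?ffunE // => x xe _.
have := (xe e0, xe e1); rewrite !ffunE /= => -[/(_ erefl) h1 /(_ erefl) h2].
exists (x e2); apply/ffunP; apply: forall_ord3; rewrite !ffunE /=; lra.
Qed.

Lemma parallel_not_ICW : ~ ICW P.
Proof.
move=> [_ H].
pose y (i : nat) : {ffun 'I_3 -> R} := nth (vec3 0 0 1)
  [:: vec3 0 0 1; vec3 2^-1 2^-1 2^-1; vec3 1 0 2^-1; vec3 1 0 1] i.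
have walk : circuit_walk P 3 y.
  split.
  (* The end points of the walk are the unique maximizers of [- x e0 - x e1 + x e2] and of
     [x e0 + x e2]. *)
  - exists (vec3 (-1) (-1) 1), 1; split=> [x /in_parallel[]|x].
      by rewrite !big_ord_recl big_ord0 !ffunE /=; lra.
    rewrite in_parallel !big_ord_recl big_ord0 !ffunE /=; split=> [->|[[*]*]].
      by rewrite !ffunE /=; split; [split|]; lra.
    by apply/ffunP; apply: forall_ord3; rewrite !ffunE /=; lra.
  - exists (vec3 1 0 1), 2; split=> [x /in_parallel[]|x].
      by rewrite !big_ord_recl big_ord0 !ffunE /=; lra.
    rewrite in_parallel !big_ord_recl big_ord0 !ffunE /=; split=> [->|[[*]*]].
      by rewrite !ffunE /=; split; [split|]; lra.
    by apply/ffunP; apply: forall_ord3; rewrite !ffunE /=; lra.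
  - by do 4 (case=> [_|]; first by apply/in_parallel; rewrite !ffunE /=; split; lra).
  - case=> [_|[_|[_|//]]].
    (* The three steps are stopped by [x e0 + x e1 <= 1], [0 <= x e1] and [x e2 <= 1]
       respectively. *)
    + exists (vec3 1 1 (-1)), 2^-1; split; first exact: circuit_11N.
      * lra.
      * by apply/ffunP; apply: forall_ord3; rewrite !ffunE /=; lra.
      * by move=> a ha /in_parallel[]; rewrite !ffunE /=; lra.
    + exists (vec3 1 (-1) 0), 2^-1; split; first exact: circuit_1N0.
      * lra.
      * by apply/ffunP; apply: forall_ord3; rewrite !ffunE /=; lra.
      * by move=> a ha /in_parallel[]; rewrite !ffunE /=; lra.
    + exists (vec3 0 0 1), 2^-1; split; first exact: circuit_001.
      * lra.
      * by apply/ffunP; apply: forall_ord3; rewrite !ffunE /=; lra.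
      * by move=> a ha /in_parallel[]; rewrite !ffunE /=; lra.
have /intrP[z] := H _ _ walk 1%N isT e0; rewrite ffunE /= => hz.
have : (2 * z)%:~R = (1 : int)%:~R :> R by rewrite intrM -hz; lra.
by move/intr_inj; lia.
Qed.

End ParallelPair.

(** * A transportation polytope that is not VCW *)

Section Rectangle.
Variables (m n : nat) (i i' : 'I_m) (a b : 'I_n).

(** An alternating 4-cycle of the complete bipartite graph, written as the product of two
    differences of unit vectors. *)
Definition rectangle : {ffun 'I_m * 'I_n -> int} :=
  [ffun p => ((p.1 == i)%:R - (p.1 == i')%:R) * ((p.2 == a)%:R - (p.2 == b)%:R)].

Lemma rectangle_balanced : balanced rectangle.
Proof.
have ind (T : finType) (k : T) : \sum_l (l == k)%:R = 1 :> int.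
  by rewrite (bigD1 k) //= eqxx big1 ?addr0 // => l /negbTE->.
by split=> [k|k]; under eq_bigr do rewrite ffunE /=; rewrite -?mulr_sumr -?mulr_suml;
  rewrite sumrB !ind subrr ?mulr0 ?mul0r.
Qed.

(** Only the four corners can be nonzero, and each row and column sum makes adjacent corners
    opposite. *)
Lemma balanced_rectangle (R : realType) (x : {ffun 'I_m * 'I_n -> R}) :
  i != i' -> a != b -> balanced x -> (forall p, rectangle p = 0 -> x p = 0) ->
  x = [ffun p => x (i, a) * (rectangle p)%:~R].
Proof.
move=> ii ab [xr xc] x0.
have out p : ~~ ((p.1 \in [:: i; i']) && (p.2 \in [:: a; b])) -> x p = 0.
  case: p => k l /=; rewrite !inE !negb_and !negb_or => h; apply: x0.
  rewrite ffunE /=.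
  by case/orP: h => /andP[/negbTE-> /negbTE->]; rewrite subrr ?mul0r ?mulr0.
have row k : x (k, a) = - x (k, b).
  apply/eqP; rewrite -addr_eq0 -(xr k) (bigD1 a) //= (bigD1 b) 1?eq_sym //=.
  rewrite big1 ?addr0 // => l /andP[la lb].
  by apply: out; rewrite /= !inE (negbTE la) (negbTE lb) andbF.
have col l : x (i', l) = - x (i, l).
  apply/eqP; rewrite -addr_eq0 addrC -(xc l) (bigD1 i) //= (bigD1 i') 1?eq_sym //=.
  rewrite big1 ?addr0 // => k /andP[ki ki'].
  by apply: out; rewrite /= !inE (negbTE ki) (negbTE ki').
apply/ffunP => -[k l]; rewrite !ffunE /=.
have [/andP[]|o] := boolP ((k \in [:: i; i']) && (l \in [:: a; b])); last first.
  have g0 : rectangle (k, l) = 0.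
    rewrite ffunE /=; move: o; rewrite !inE !negb_and !negb_or.
    by case/orP=> /andP[/negbTE-> /negbTE->]; rewrite subrr ?mul0r ?mulr0.
  by rewrite (x0 (k, l) g0); move: g0; rewrite ffunE /= => ->; rewrite mulr0.
have [ii' ba] : (i' == i) = false /\ (b == a) = false.
  by split; apply/negbTE; rewrite eq_sym.
rewrite !inE => /orP[] /eqP-> /orP[] /eqP->;
  rewrite !eqxx ?(negbTE ii) ?(negbTE ab) ?ii' ?ba ?col ?row /=; ring.
Qed.

Lemma rectangle_circuit (R : realType) u v :
  i != i' -> a != b -> circuit (transportation R u v) rectangle.
Proof.
move=> ii ab; apply: (circuitI (e0 := (i, a))).
- by apply/in_ker_transportation/balanced_int_vec/rectangle_balanced.
- by rewrite ffunE /= !eqxx (negbTE ii) (negbTE ab).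
move=> x /in_ker_transportation bx; rewrite supp_int_vec le_supp_transportation.
move=> /subsetP sub; exists (x (i, a)); apply: balanced_rectangle => // p g0.
by apply/eqP; have := sub p; rewrite !inE g0 eqxx; case: eqP => // _ /(_ isT).
Qed.

End Rectangle.

(** Since coordinates are nonnegative, minus the indicator of [Z] exposes the face where the cells
    of [Z] are 0. *)
Lemma zero_face_vertex (R : realType) m n (u : 'I_m -> nat) (v : 'I_n -> nat)
    (Z : {set 'I_m * 'I_n}) (x : {ffun 'I_m * 'I_n -> R}) :
  in_poly (transportation R u v) x -> (forall p, p \in Z -> x p = 0) ->
  (forall z, in_poly (transportation R u v) z ->
     (forall p, p \in Z -> z p = 0) -> z = x) ->
  vertex (transportation R u v) x.
Proof.
move=> Px xZ uniq.
have sumE z : \sum_p [ffun p => - (p \in Z)%:R : R] p * z p = - \sum_(p in Z) z p.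
  rewrite [in RHS]big_mkcond -sumrN; apply: eq_bigr => p _; rewrite ffunE.
  by rewrite mulNr; case: (p \in Z); rewrite ?mul1r ?mul0r.
have pos z : in_poly (transportation R u v) z -> forall p, 0 <= z p.
  by move=> /in_transportation[_ _ H] [].
exists [ffun p => - (p \in Z)%:R], 0; split=> [z Pz|z].
  by rewrite sumE oppr_le0 sumr_ge0 // => p _; exact: pos.
split=> [->|[Pz]]; first by rewrite sumE big1 ?oppr0.
rewrite sumE => /eqP; rewrite oppr_eq0 => /eqP z0; apply: uniq => //.
by apply: psumr_eq0P z0 => p _; exact: pos.
Qed.

Definition table (W : nmodType) m n (s : seq (seq W)) : {ffun 'I_m * 'I_n -> W} :=
  [ffun p : 'I_m * 'I_n => nth 0 (nth [::] s p.1) p.2].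

Arguments table {W m n}.

Lemma forall_ord2 (P : 'I_2 -> Prop) : P ord0 -> P (lift ord0 ord0) -> forall i, P i.
Proof. by move=> *; do 2 apply: forall_ordS => //; case. Qed.

Lemma forall_cell (m n : nat) (P : 'I_m * 'I_n -> Prop) :
  (forall i j, P (i, j)) -> forall p, P p.
Proof. by move=> H []. Qed.

Section Examples.
Variable R : realType.

Local Notation c1 := (lift ord0 ord0).
Local Notation c2 := (lift ord0 (lift ord0 ord0)).

Definition demand_rows : 'I_2 -> nat := fun i => nth 0%N [:: 3; 2] i.
Definition demand_cols : 'I_3 -> nat := fun j => nth 0%N [:: 2; 1; 2] j.

Local Notation T := (transportation R demand_rows demand_cols).

Lemma in_demand z : in_poly T z -> [/\
  z (ord0, ord0) + z (ord0, c1) + z (ord0, c2) = 3,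
  z (c1, ord0) = 2 - z (ord0, ord0),
  z (c1, c1) = 1 - z (ord0, c1),
  z (c1, c2) =
    2 - z (ord0, c2) & forall p, 0 <= z p].
Proof.
move=> /in_transportation[H1 H2 H3].
have := (H1 ord0, H2 ord0, H2 c1, H2 c2).
rewrite /demand_rows /demand_cols !big_ord_recl !big_ord0 /= => -[[[h1 h2] h3] h4].
by split; try lra; case.
Qed.

Lemma table_in_demand (a b c : R) :
  0 <= a <= 2 -> 0 <= b <= 1 -> 0 <= c <= 2 -> a + b + c = 3 ->
  in_poly T (table [:: [:: a; b; c]; [:: 2 - a; 1 - b; 2 - c]]).
Proof.
move=> /andP[? ?] /andP[? ?] /andP[? ?] s; apply/in_transportation; split.
- by apply: forall_ord2; rewrite /demand_rows /demand_cols !big_ord_recl big_ord0 !ffunE /=; lra.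
- by apply: forall_ord3; rewrite /demand_rows /demand_cols !big_ord_recl big_ord0 !ffunE /=; lra.
- by apply: forall_ord2; apply: forall_ord3; rewrite ffunE /=; lra.
Qed.

Lemma transportation_not_VCW : ~ VCW T.
Proof.
move=> [_ H].
pose pt (a b c : R) : {ffun 'I_2 * 'I_3 -> R} :=
  table [:: [:: a; b; c]; [:: 2 - a; 1 - b; 2 - c]].
pose y i := nth (pt 2 0 1) [:: pt 2 0 1; pt 1 1 1; pt 2 1 0] i.
have walk : circuit_walk T 2 y.
  split.
  - apply: (@zero_face_vertex _ _ _ _ _ [set (ord0, c1); (c1, ord0)]).
    + by apply: table_in_demand; lra.
    + by move=> p; rewrite !inE => /orP[] /eqP->; rewrite ffunE /=; lra.
    move=> z /in_demand[h1 h2 h3 h4 _] hz.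
    have := (hz (ord0, c1), hz (c1, ord0)).
    rewrite !inE !eqxx orbT => -[/(_ isT) z1 /(_ isT) z2].
    apply/ffunP; apply: forall_cell; apply: forall_ord2; apply: forall_ord3;
      rewrite ffunE /=; lra.
  - apply: (@zero_face_vertex _ _ _ _ _ [set (ord0, c2); (c1, ord0)]).
    + by apply: table_in_demand; lra.
    + by move=> p; rewrite !inE => /orP[] /eqP->; rewrite ffunE /=; lra.
    move=> z /in_demand[h1 h2 h3 h4 _] hz.
    have := (hz (ord0, c2), hz (c1, ord0)).
    rewrite !inE !eqxx orbT => -[/(_ isT) z1 /(_ isT) z2].
    apply/ffunP; apply: forall_cell; apply: forall_ord2; apply: forall_ord3;
      rewrite ffunE /=; lra.
  - by do 3 (case=> [_|]; first by apply: table_in_demand; lra).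
  - case=> [_|[_|//]].
    (* The first step empties cell [(c1, c1)] and the second empties [(ord0, c2)], so neither can be
       longer. *)
    + exists (rectangle ord0 c1 c1 ord0), 1; split.
      * exact: rectangle_circuit.
      * lra.
      * apply/ffunP; apply: forall_cell; apply: forall_ord2; apply: forall_ord3;
          rewrite !ffunE /=; lra.
      * move=> a ha /in_demand[_ _ _ _ /(_ (c1, c1))].
        rewrite !ffunE /=; lra.
    + exists (rectangle ord0 c1 ord0 c2), 1; split.
      * exact: rectangle_circuit.
      * lra.
      * apply/ffunP; apply: forall_cell; apply: forall_ord2; apply: forall_ord3;
          rewrite !ffunE /=; lra.
      * move=> a ha /in_demand[_ _ _ _ /(_ (ord0, c2))].
        rewrite !ffunE /=; lra.
have v1 := H _ _ walk 1%N isT.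
(* The intermediate point is the midpoint of [pt 2 1 0] and [pt 0 1 2]. *)
pose d : {ffun 'I_2 * 'I_3 -> R} := table [:: [:: 1; 0; -1]; [:: -1; 0; 1]].
have : d = 0.
  apply: (vertex_not_midpoint v1).
    rewrite (_ : _ + d = pt 2 1 0); first by apply: table_in_demand; lra.
    by apply/ffunP; apply: forall_cell; apply: forall_ord2; apply: forall_ord3;
      rewrite !ffunE /=; lra.
  rewrite (_ : _ - d = pt 0 1 2); first by apply: table_in_demand; lra.
  by apply/ffunP; apply: forall_cell; apply: forall_ord2; apply: forall_ord3;
    rewrite !ffunE /=; lra.
by move=> /ffunP/(_ (ord0, ord0))/eqP; rewrite !ffunE /= oner_eq0.
Qed.

End Examples.

(** * A bounded-size partition polytope that is not ECW *)

Section FreePartition.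
Variable R : realType.

(** The bounds 0 and [n] follow from the other constraints, so this is a product of simplices; the
    size rows still enter the supports that define circuits. *)
Definition free_partition (k n : nat) :=
  bounded_partition R n (fun _ : 'I_k => 0%N) (fun _ => n).

Section General.
Variables k n : nat.
Local Notation Q := (free_partition k n).
Implicit Types (x z : {ffun 'I_k * 'I_n -> R}) (g : {ffun 'I_k * 'I_n -> int}).

Lemma in_free_partition z : in_poly Q z <-> column_stochastic z.
Proof.
split=> [/in_bounded_partition[H1 _ _ H4]|sz]; first by split=> // -[].
have [H1 H2] := sz; apply/in_bounded_partition; split=> // i.
  by apply: sumr_ge0.
rewrite -[in leRHS](card_ord n) -sumr_const; apply: ler_sum => j _.
exact: column_stochastic_le1.
Qed.

Lemma in_ker_free_partition z : in_ker Q z <-> forall j, \sum_i z (i, j) = 0.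
Proof. by split=> H j; have := H j; rewrite /= row_dot_snd. Qed.

Lemma free_partition_GCW : GCW Q.
Proof.
move=> x vx [i j]; have /in_free_partition sx := vertex_in_poly vx.
have [s pos] := sx; apply/negPn/negP => xij.
have [|i' ii' xi'] := @int_sum_other _ _ (fun i => x (i, j)) i _ xij.
  by rewrite s.
have gt0 l : x (l, j) \isn't a Num.int -> 0 < x (l, j).
  by move=> h; rewrite lt_neqAle pos andbT; apply: contraNneq h => <-.
(* A column with one fractional entry has a second; moving [u] between the two in either direction
   stays feasible. *)
pose u := Num.min (x (i, j)) (x (i', j)).
have u0 : 0 < u by rewrite lt_min !gt0.
have [ui ui'] : u <= x (i, j) /\ u <= x (i', j) by rewrite !ge_min !lexx orbT.
pose e (p : 'I_k * 'I_n) : R := ((p.1 == i)%:R - (p.1 == i')%:R) * (p.2 == j)%:R.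
have inQ (t : R) : `|t| <= u -> in_poly Q [ffun p => x p + t * e p].
  rewrite ler_norml => /andP[t1 t2]; apply/in_free_partition; split=> [l|[a b]].
    under eq_bigr do rewrite ffunE; rewrite big_split /= s -mulr_sumr.
    rewrite -mulr_suml sumrB /=.
    have ind (c : 'I_k) : \sum_a (a == c)%:R = 1 :> R.
      by rewrite (bigD1 c) //= eqxx big1 ?addr0 // => a /negbTE->.
    by rewrite !ind subrr mul0r mulr0 addr0.
  rewrite ffunE /e /=; case: (eqVneq b j) => [->|_]; last first.
    by rewrite !mulr0 addr0.
  case: (eqVneq a i) => [->|_].
    by rewrite eq_sym (negbTE ii') /=; lra.
  case: (eqVneq a i') => [->|_] /=; first lra.
  by have := pos (a, j); lra.
have : [ffun p => u * e p] = 0 :> {ffun 'I_k * 'I_n -> R}.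
  apply: (vertex_not_midpoint vx).
    rewrite (_ : x + _ = [ffun p => x p + u * e p]).
      by apply: inQ; rewrite gtr0_norm.
    by apply/ffunP => p; rewrite !ffunE.
  rewrite (_ : x - _ = [ffun p => x p + (- u) * e p]).
    by apply: inQ; rewrite normrN gtr0_norm.
  by apply/ffunP => p; rewrite !ffunE mulNr.
move=> /ffunP/(_ (i, j)); rewrite !ffunE /e /= !eqxx eq_sym (negbTE ii') /=.
by move: u0; lra.
Qed.

Lemma free_partition_maximal_step x y : (forall g, circuit Q g -> forall p, (`|g p| <= 1)%N) ->
  in_poly Q x -> integral_point x -> in_poly Q y -> maximal_step Q x y ->
  integral_point y.
Proof.
move=> unit /in_free_partition[sx _] Ix /in_free_partition[_ pos] [g [a [cg a0 yE max]]].
rewrite yE in pos *; apply: unit_maximal_step max => //; first exact: unit.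
move=> b posb; apply/in_free_partition; split=> // j.
have [Kg _ _ _] := cg; have /in_ker_free_partition/(_ j) := Kg.
under eq_bigr do rewrite ffunE; move=> gj.
by under eq_bigr do rewrite ffunE; rewrite big_split /= sx -mulr_sumr gj mulr0 addr0.
Qed.

(** Unit circuits keep a walk integral, and every integral point is a vertex. *)
Lemma free_partition_VCW :
  (forall g, circuit Q g -> forall p, (`|g p| <= 1)%N) -> VCW Q.
Proof.
move=> unit; split; first exact: free_partition_GCW.
move=> l y [v0 _ Py st] i il.
have : integral_point (y i).
  elim: i il => [|i IH] il; first exact: free_partition_GCW v0.
  by apply: free_partition_maximal_step (st i il); auto using ltnW.
by apply: integral_vertex (Py i il) => z /in_free_partition.
Qed.

End General.

(** * Two items in two clusters: the square *)

Local Notation Q := (free_partition 2 2).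
Local Notation i0 := (ord0 : 'I_2).
Local Notation i1 := (lift ord0 ord0 : 'I_2).

Lemma square_circuit_unit g : circuit Q g -> forall p, (`|g p| <= 1)%N.
Proof.
move=> cg; have [Kg _ _ _] := cg.
have neg j : g (i1, j) = - g (i0, j).
  have /in_ker_free_partition/(_ j) := Kg.
  rewrite !big_ord_recl big_ord0 !ffunE addr0 -rmorphD /= => /eqP.
  by rewrite intr_eq0 addrC addr_eq0 => /eqP.
pose h j := g (i0, j).
(* An [M] that divides and bounds every entry equals 1 by coprimality. *)
suff [M [hM M1]] : exists M, (forall j, M %| `|h j|)%N /\ forall j, (`|h j| <= M)%N.
  have M1' : M = 1%N.
    apply: (circuit_dvd cg); apply: forall_cell; apply: forall_ord2 => j.
      exact: hM.
    by rewrite neg abszN; exact: hM.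
  rewrite M1' in M1; apply: forall_cell; apply: forall_ord2 => j; first exact: M1.
  by rewrite neg abszN; exact: M1.
have [e|ne] := eqVneq (h ord0 + h i1) 0.
  have e' : h i1 = - h ord0 by apply/eqP; rewrite -addr_eq0 addrC e.
  by exists `|h ord0|%N; split; apply: forall_ord2; rewrite ?e' ?abszN.
have [j hj] : exists j, h j != 0.
  have [z|] := eqVneq (h ord0) 0; last by exists ord0.
  by exists i1; apply: contraNneq ne => z'; rewrite z z'.
(* If [g] changes the cluster sizes, its support contains all size rows, hence also the support of
   moving the single item [j]; so [g] moves that item only. *)
pose x : {ffun 'I_2 * 'I_2 -> R} :=
  [ffun p => ((p.1 == i0)%:R - (p.1 == i1)%:R) * (p.2 == j)%:R].
have rsum i : row_dot (fun q => (q.1 == i)%:R) (int_vec R g) != 0.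
  rewrite row_dot_fst !big_ord_recl big_ord0 !ffunE addr0 -rmorphD intr_eq0.
  by move: i; apply: forall_ord2; rewrite // !neg -opprD oppr_eq0.
have [|||t xE] := @circuit_scalar _ _ _ g x cg.
- by apply/set0Pn; exists (inl (inr i0)); rewrite inE; exact: rsum.
- apply/in_ker_free_partition => l.
  by rewrite !big_ord_recl big_ord0 !ffunE /=; ring.
- apply/subsetP => -[[i _|i _]|[i l]].
  + by rewrite inE /= row_dot_opp oppr_eq0; exact: rsum.
  + by rewrite inE; exact: rsum.
  rewrite !inE /= !row_dot_delta !oppr_eq0 !ffunE /=.
  case: (eqVneq l j) => [-> _|]; last by rewrite mulr0 eqxx.
  by rewrite intr_eq0; move: i; apply: forall_ord2; rewrite ?neg ?oppr_eq0.
have xj l : (l == j)%:R = t * (h l)%:~R :> R.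
  by have /ffunP/(_ (i0, l)) := xE; rewrite !ffunE /= => <-; ring.
have t0 : t != 0.
  by have := xj j; apply: contra_eq_neq => ->; rewrite mul0r eqxx oner_eq0.
have hl l : l != j -> h l = 0.
  move=> /negbTE lj; have := xj l; rewrite lj => /esym/eqP.
  by rewrite mulf_eq0 (negbTE t0) intr_eq0 => /eqP.
by exists `|h j|%N; split=> l; have [->//|/hl->] := eqVneq l j.
Qed.

Lemma square_not_ECW : ~ ECW Q.
Proof.
move=> [_ H].
pose pt (a b : R) : {ffun 'I_2 * 'I_2 -> R} :=
  table [:: [:: a; b]; [:: 1 - a; 1 - b]].
have Ppt (a b : R) : 0 <= a <= 1 -> 0 <= b <= 1 -> in_poly Q (pt a b).
  move=> /andP[? ?] /andP[? ?]; apply/in_free_partition; split.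
    by apply: forall_ord2; rewrite !big_ord_recl big_ord0 !ffunE /=; ring.
  by apply: forall_cell; apply: forall_ord2; apply: forall_ord2; rewrite ffunE /=; lra.
have P0 : in_poly Q (pt 1 0) by apply: Ppt; lra.
have P1 : in_poly Q (pt 0 1) by apply: Ppt; lra.
have vtx (a b : nat) : in_poly Q (pt a%:R b%:R) -> vertex Q (pt a%:R b%:R).
  move=> Pp; apply: integral_vertex => // [z /in_free_partition//|].
  by apply: forall_cell; apply: forall_ord2; apply: forall_ord2;
    rewrite ffunE /=; try apply: rpredB; rewrite ?rpred1 ?natr_int.
pose y i := nth (pt 1 0) [:: pt 1 0; pt 0 1] i.
have walk : circuit_walk Q 1 y.
  split; [exact: (vtx 1%N 0%N)|exact: (vtx 0%N 1%N)| |].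
    by do 2 case=> //.
  case=> // _; exists (rectangle i0 i1 i1 i0), 1; split=> //.
  - apply: (circuitI (e0 := (i0, i0))); first 1 last.
    + by rewrite ffunE.
    + move=> x /in_ker_free_partition xc /subsetP sub.
      exists (x (i0, i1)); apply: balanced_rectangle => //.
        (* Swapping the items preserves the cluster sizes, so the size rows lie outside its support
           and [x] preserves them too. *)
        split=> // i; rewrite -row_dot_fst; apply/eqP.
        have := sub (inl (inr i)); rewrite !inE /= !row_dot_fst.
        have [-> _] : balanced (int_vec R (rectangle i0 i1 i1 i0)).
          by apply/balanced_int_vec/rectangle_balanced.
        by rewrite eqxx; case: eqP => // _ /(_ isT).
      move=> p g0; apply/eqP; have := sub (inr p).
      rewrite !inE /=; case: p g0 => i j g0.
      rewrite !row_dot_delta !oppr_eq0 [int_vec _ _ _]ffunE g0 eqxx.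
      by case: eqP => // _ /(_ isT).
    apply/in_ker_free_partition => j.
    by have [_ ->] : balanced (int_vec R (rectangle i0 i1 i1 i0))
      by apply/balanced_int_vec/rectangle_balanced.
  - by apply/ffunP; apply: forall_cell; apply: forall_ord2; apply: forall_ord2;
      rewrite !ffunE /=; lra.
  - move=> a ha /in_free_partition[_ /(_ (i0, i0))]; rewrite !ffunE /=; lra.
have [_ /(_ 0%N isT) [_ [c [delta [le F]]]]] := H _ _ walk.
have end0 : segment (pt 1 0) (pt 0 1) (pt 1 0).
  by exists 0; split; [lra|apply/ffunP => p; rewrite !ffunE; ring].
have end1 : segment (pt 1 0) (pt 0 1) (pt 0 1).
  by exists 1; split; [lra|apply/ffunP => p; rewrite !ffunE; ring].
have [_ c0] := (F _).1 end0; have [_ c1] := (F _).1 end1.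
have P00 : in_poly Q (pt 0 0) by apply: Ppt; lra.
have P11 : in_poly Q (pt 1 1) by apply: Ppt; lra.
(* Both diagonals have the same midpoint, so a linear form equal to its bound [delta] along one
   diagonal equals it at the other two corners, which are not on the segment. *)
have sumE : \sum_e c e * pt 0 0 e + \sum_e c e * pt 1 1 e =
    \sum_e c e * pt 1 0 e + \sum_e c e * pt 0 1 e.
  rewrite -!big_split; apply: eq_bigr => /= e _; rewrite -!mulrDr; congr (_ * _).
  by move: e; apply: forall_cell; apply: forall_ord2; apply: forall_ord2;
    rewrite !ffunE /=; ring.
have : segment (pt 1 0) (pt 0 1) (pt 0 0).
  by apply/F; split=> //; have := le _ P00; have := le _ P11; lra.
move=> [t [_ /ffunP E]]; have := (E (i0, i0), E (i0, i1)).
by rewrite !ffunE /= => -[]; lra.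
Qed.

End FreePartition.

Theorem theorem4 (R : realType) :
  (exists (E : finType) (M : matroid E),
     GCW (matroid_polytope R M) /\ ~ ICW (matroid_polytope R M)) /\
  (exists (m n : nat) (u : 'I_m -> nat) (v : 'I_n -> nat),
     ICW (transportation R u v) /\ ~ VCW (transportation R u v)) /\
  (exists (k n : nat) (kmin kmax : 'I_k -> nat),
     VCW (bounded_partition R n kmin kmax) /\
     ~ ECW (bounded_partition R n kmin kmax)) /\
  (forall (k n : nat) (kappa : 'I_k -> nat),
     ECW (fixed_partition R n kappa)).
Proof.
split; first by exists _, parallel_matroid; split;
  [exact: parallel_GCW|exact: parallel_not_ICW].
split; first by exists 2%N, 3%N, demand_rows, demand_cols; split;
  [exact: transportation_ICW|exact: transportation_not_VCW].
split; last by move=> k n kappa; exact: fixed_partition_ECW.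
exists 2%N, 2%N, (fun=> 0%N), (fun=> 2%N); split; last exact: square_not_ECW.
exact/free_partition_VCW/square_circuit_unit.
Qed.
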